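(* Let $k\ge 1$ be an integer. Then for all integers $n\ge 0$, $$(-1)^{k}\sum_{j=-k}^k(-1)^j\, b_3\!\left(n-\frac{j(3j-1)}{2}\right) +(-1)^{k-1} \rho_{3}(n)\ge 0.$$
   Context: A partition of $n$ is a non-increasing sequence of positive integers (parts) with sum $n$; the empty partition is the only partition of $0$. $b_3(n)$ denotes the number of $3$-regular partitions of $n$, i.e. partitions of $n$ with no part divisible by $3$, with the convention $b_3(x)=0$ if $x$ is not a non-negative integer. For a positive integer $R$, $\rho_R(n):=(-1)^i$ if $n=Ri(3i-1)/2$ for some $i\in\mathbb Z$, and $\rho_R(n):=0$ otherwise. *)

(* Defs.v *)
From mathcomp Require Import all_boot all_order all_algebra.
From mathcomp Require Import boolp.
From mathcomp Require Import zify.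

Set Implicit Arguments.
Unset Strict Implicit.
Unset Printing Implicit Defensive.

Import GRing.Theory.

Local Open Scope ring_scope.

Definition is_partition (n : nat) (p : seq nat) : bool :=
  [&& sorted geq p, all (fun a => 0 < a)%N p & sumn p == n].

Definition is_regular_partition (l n : nat) (p : seq nat) : bool :=
  is_partition n p && all (fun a => ~~ (l %| a)%N) p.

(* A partition of n has at most n parts, each at most n, so all of them occur
   among the sequences of length at most n over 'I_n.+1; see
   nb_regular_partitionsE. *)
Definition nb_regular_partitions (l n : nat) : nat :=
  #|[set s : n.-bseq 'I_n.+1 |
      is_regular_partition l n [seq nat_of_ord a | a <- s]]|.

Definition b3 (x : int) : int :=
  if x is Posz n then (nb_regular_partitions 3 n)%:Z else 0.

(* The division is exact, and pent is injective on int. *)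
Definition pent (j : int) : int := ((j * (3 * j - 1)) %/ 2)%Z.

(* For R > 0 the chosen index i is the only one; see rhoE. *)
Definition rho (R n : nat) : int :=
  if pselect (exists i : int, n%:Z = R%:Z * pent i) is left ex_i
  then (-1) ^ projT1 (cid ex_i) else 0.

Lemma nb_regular_partitionsE (l n : nat) (ps : seq (seq nat)) :
  uniq ps -> (forall p, (p \in ps) = is_regular_partition l n p) ->
  nb_regular_partitions l n = size ps.
Proof.
move=> ps_uniq psE.
pose f (s : n.-bseq 'I_n.+1) := [seq nat_of_ord a | a <- s].
have f_inj : injective f.
  by move=> s t /(inj_map val_inj) st; apply: val_inj.
rewrite /nb_regular_partitions -/f cardE -(size_map f).
apply: perm_size; apply: uniq_perm => //.
  by rewrite map_inj_uniq // enum_uniq.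
move=> p; rewrite psE; apply/mapP/idP.
  by move=> [s]; rewrite mem_enum inE => ? ->.
move=> pP; have /andP[/and3P[_ p_gt0 /eqP p_sum] _] := pP.
have sz_p : (size p <= n)%N.
  rewrite -p_sum; elim: p p_gt0 {pP p_sum} => //= a p IH /andP[a0 /IH].
  lia.
have le_p a : a \in p -> (a < n.+1)%N.
  rewrite ltnS -p_sum; elim: p {pP p_gt0 p_sum sz_p} => //= b p IH.
  by rewrite inE => /orP[/eqP->|/IH]; lia.
pose s := [seq (inord a : 'I_n.+1) | a <- p].
have sz_s : (size s <= n)%N by rewrite size_map.
have fs : p = f (Bseq sz_s).
  rewrite /f /= /s -map_comp -[LHS]map_id; apply/eq_in_map => a ap /=.
  by rewrite inordK // le_p.
by exists (Bseq sz_s) => //; rewrite mem_enum inE -/(f _) -fs.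
Qed.

Lemma pentE (j : int) : 2 * pent j = j * (3 * j - 1).
Proof.
rewrite /pent mulrC divzK //.
have [q [->|->]] : exists q : int, j = 2 * q \/ j = 2 * q + 1.
- exists (j %/ 2)%Z; lia.
- by rewrite -mulrA dvdz_mulr.
- have -> : 3 * (2 * q + 1) - 1 = 2 * (3 * q + 1) :> int by lia.
  by rewrite mulrCA dvdz_mulr.
Qed.

Lemma pent_inj : injective pent.
Proof.
move=> i j ij; have := pentE i; rewrite ij pentE => e.
have /eqP : (i - j) * (3 * (i + j) - 1) = 0 :> int by nia.
by rewrite mulf_eq0 => /orP[] /eqP; lia.
Qed.

Lemma rhoE (R n : nat) (i : int) : (0 < R)%N ->
  n%:Z = R%:Z * pent i -> rho R n = (-1) ^ i.
Proof.
move=> R0 ni; rewrite /rho; case: pselect => [ex_i|[]]; last by exists i.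
case: (cid ex_i) => j /= nj; congr (_ ^ _); apply: pent_inj.
by apply: (@mulfI _ R%:Z); [lia | rewrite -nj].
Qed.

(* Main.v *)
Require Import Defs.
From mathcomp Require Import all_boot all_order all_algebra.
From mathcomp Require Import boolp zify ring.

(** Write t_j for (-1)^j b_3(n - j(3j-1)/2). Two facts give the theorem.

    The complete sum of the t_j over all integers j is rho_3(n)
    ([b3_pentagonal]).  By Euler's pentagonal number theorem it is the
    coefficient of q^n in
      (q;q)_oo * (q^3;q^3)_oo / (q;q)_oo = (q^3;q^3)_oo,
    and the same theorem applied to q^3 identifies this coefficient.  The
    expression to be bounded is therefore, up to the sign (-1)^(k-1), the tail
    of the complete sum over |j| > k.

    The function b_3 is nondecreasing ([le_b3]), because 1 is an allowed part.
    Grouping the indices j and -j, the tail becomes an alternating sum of terms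
      d_j = b_3(n - j(3j-1)/2) + b_3(n - j(3j+1)/2)
    that are nonnegative and nonincreasing in j, so that it has the sign of its
    first term ([alternating_sum_bounds]).

    Infinite products are replaced by finite ones modulo a power of the
    variable.  The pentagonal number theorem comes from an identity of Shanks
    ([shanks_identity]), an exact polynomial identity which compares
    (1 - x)...(1 - x^n) to the truncated pentagonal series up to a multiple of
    x^(n+1).  The generating function of b_3 is handled by letting the allowed
    parts in one at a time ([nb_restrictedS], [restricted_poly_prod]). *)

Set Implicit Arguments.
Unset Strict Implicit.
Unset Printing Implicit Defensive.

Import Order.TTheory GRing.Theory Num.Theory.

Local Open Scope ring_scope.

(** * Shanks's finite form of the pentagonal number theorem *)

Section Shanks.
Variables (R : comNzRingType) (x : R).

(** This is the quotient P_n / P_s, where P_n = (1 - x)...(1 - x^n); as a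
    product it makes sense in any commutative ring. *)
Definition qprod (s n : nat) : R := \prod_(s <= i < n) (1 - x ^+ i.+1).

Definition shanks_term (n s : nat) : R :=
  (-1) ^+ s * qprod s n * x ^+ (s * n + 'C(s.+1, 2)).

(** The two terms of the pentagonal series with indices [j] and [- j]: the
    exponents j(3j-1)/2 and j(3j+1)/2 are written with binomials, which need no
    exact division (see [pent_pos] and [pent_neg]). *)
Definition pent_pair (j : nat) : R :=
  (-1) ^+ j * (x ^+ (j * j + 'C(j, 2)) + x ^+ (j * j + 'C(j.+1, 2))).

Lemma qprodnn n : qprod n n = 1.
Proof. by rewrite /qprod big_geq. Qed.

Lemma qprod_recr s n : (s <= n)%N ->
  qprod s n.+1 = qprod s n * (1 - x ^+ n.+1).
Proof. by move=> sn; rewrite /qprod big_nat_recr. Qed.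

Lemma qprod_recl s n : (s < n)%N ->
  qprod s n = (1 - x ^+ s.+1) * qprod s.+1 n.
Proof. by move=> sn; rewrite /qprod big_ltn. Qed.

(** Passing from [n] to [n.+1] changes the summand of index [s] by
    (-1)^s P_n/P_s x^(sn + s(s+1)/2) (x^s - 1 - x^(n+s+1)); as
    P_n/P_s (1 - x^s) = P_n/P_(s-1), the part in x^s - 1 cancels the part in
    x^(n+s) of the previous index. *)
Lemma shanks_telescope n m : (m <= n)%N ->
  \sum_(s < m.+1) (shanks_term n.+1 s - shanks_term n s)
  = - (-1) ^+ m * qprod m n * x ^+ (m.+1 * n.+1 + 'C(m.+1, 2)).
Proof.
elim: m => [_|m IH mn].
  rewrite big_ord_recr big_ord0 /= /shanks_term qprod_recr // bin_small //.
  rewrite !mul0n !mul1n !addn0 !expr0.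
  ring.
rewrite big_ord_recr /= IH ?(ltnW mn) // (qprod_recl mn).
rewrite /shanks_term qprod_recr //.
have -> : 'C(m.+2, 2) = ('C(m.+1, 2) + m.+1)%N by rewrite binS bin1.
have -> : (m.+1 * n.+1 + ('C(m.+1, 2) + m.+1)
           = m.+1 * n + 'C(m.+1, 2) + m.+1 + m.+1)%N by lia.
have -> : (m.+1 * n.+1 + 'C(m.+1, 2)
           = m.+1 * n + 'C(m.+1, 2) + m.+1)%N by lia.
have -> : (m.+2 * n.+1 + ('C(m.+1, 2) + m.+1)
           = m.+1 * n + 'C(m.+1, 2) + m.+1 + m.+1 + n.+1)%N by lia.
have -> : (m.+1 * n + ('C(m.+1, 2) + m.+1)
           = m.+1 * n + 'C(m.+1, 2) + m.+1)%N by lia.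
rewrite !(exprD x _ m.+1) !(exprD x _ n.+1) !(exprD x _ m.+1) (exprS (-1)).
ring.
Qed.

(** By induction on [n]: what is left of the telescoping sum and the new
    summand of index [n.+1] are the two terms of the next [pent_pair]. *)
Lemma shanks_identity n :
  \sum_(s < n.+1) shanks_term n s = 1 + \sum_(j < n) pent_pair j.+1.
Proof.
elim: n => [|n IH].
  rewrite big_ord_recr !big_ord0 /= /shanks_term qprodnn bin_small //.
  by rewrite mul0n !expr0 add0r addr0 !mulr1.
rewrite big_ord_recr /= [in RHS]big_ord_recr /= addrA -IH.
have := shanks_telescope (leqnn n); rewrite sumrB => /eqP.
rewrite subr_eq => /eqP ->.
rewrite /shanks_term /pent_pair !qprodnn exprS.
ring.
Qed.

(** In Shanks's sum the summand of index 0 is the whole product, and the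
    exponent sn + s(s+1)/2 is at least n + 1 for every s > 0. *)
Lemma pentagonal_congr n : exists q : R,
  qprod 0 n = 1 + \sum_(j < n) pent_pair j.+1 + x ^+ n.+1 * q.
Proof.
exists (- \sum_(s < n) (-1) ^+ s.+1 * qprod s.+1 n
                       * x ^+ (s * n + 'C(s.+2, 2) - 1)).
rewrite -shanks_identity big_ord_recl /= {1}/shanks_term mul0n bin_small //.
rewrite !expr0 mul1r mulr1 mulrN mulr_sumr -addrA -sumrB big1 ?addr0 //= => s _.
rewrite /bump /= add1n /shanks_term.
have -> : (s.+1 * n + 'C(s.+2, 2) = n.+1 + (s * n + 'C(s.+2, 2) - 1))%N.
  have : (0 < 'C(s.+2, 2))%N by rewrite bin_gt0.
  by lia.
by rewrite exprD; ring.
Qed.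

End Shanks.

(** * Partitions into parts from a given set *)

Section RestrictedPartitions.
Variable D : pred nat.

Definition restricted (m n : nat) (p : seq nat) : bool :=
  [&& is_partition n p, all D p & all (fun a => a <= m)%N p].

Lemma restricted_nil m n : restricted m n [::] = (n == 0)%N.
Proof. by rewrite /restricted /is_partition /= andbT eq_sym. Qed.

(** Removing the largest part [a] leaves a partition whose parts are bounded by
    [a]: sortedness is absorbed by the bound, which makes inductions possible. *)
Lemma restricted_cons m n a q :
  restricted m n (a :: q) =
  [&& (0 < a <= m)%N, D a, (a <= n)%N & restricted a (n - a) q].
Proof.
rewrite /restricted /is_partition /= (path_sortedE (rev_trans leq_trans)).
have -> : (a + sumn q == n)%N = (a <= n)%N && (sumn q == n - a)%N.
  by apply/eqP/andP => [<-|[an /eqP ->]]; rewrite ?leq_addr ?addKn ?subnKC.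
have [qa|] := boolP (all (fun b => b <= a)%N q); last by rewrite !andbF.
have [am|] := boolP (a <= m)%N; last by rewrite !andbF.
have -> : all (fun b => b <= m)%N q.
  by apply: sub_all qa => b /leq_trans; apply.
rewrite !andbT; case: (0 < a)%N (D a) (a <= n)%N => [] [] [] //=;
  by rewrite ?andbF.
Qed.

(** Either [m] is not a part, or it is the largest part and is removed.  The
    inner recursion, on [n], lets [m] be repeated. *)
Fixpoint restricted_enum (m : nat) : nat -> seq (seq nat) :=
  fix enum_m (n : nat) :=
    match m with
    | 0 => if n is 0 then [:: [::]] else [::]
    | m'.+1 =>
        restricted_enum m' n ++
        (if n is n'.+1 then
           if D m && (m' <= n')%N then
             [seq m :: p | p <- enum_m (n' - m')%N]
           else [::]
         else [::])
    end.

Lemma restricted_enumS m n :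
  restricted_enum m.+1 n = restricted_enum m n ++
    (if D m.+1 && (m < n)%N
     then [seq m.+1 :: p | p <- restricted_enum m.+1 (n - m.+1)] else [::]).
Proof. by case: n => [|n] //; rewrite ltn0 andbF. Qed.

Lemma mem_restricted_enum m n p :
  (p \in restricted_enum m n) = restricted m n p.
Proof.
elim: m n p => [|m IHm] n p.
  case: p => [|a q]; first by rewrite restricted_nil; case: n.
  by rewrite restricted_cons ltnNge andNb; case: n.
elim/ltn_ind: n p => n IHn p; rewrite restricted_enumS mem_cat IHm.
case: p => [|a q].
  rewrite !restricted_nil; case: ifP => _; last by rewrite orbF.
  by case: mapP => [[]|]; rewrite ?orbF.
rewrite !restricted_cons.
have -> : (a :: q \in if D m.+1 && (m < n)%N
     then [seq m.+1 :: p | p <- restricted_enum m.+1 (n - m.+1)] else [::])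
   = [&& a == m.+1, D a, (a <= n)%N & restricted a (n - a) q].
  case: ifP => [/andP[Dm mn]|Dmn].
    apply/mapP/and4P => [[q' q'P [-> ->]]|[/eqP -> _ _ qP]].
      by split=> //; rewrite -IHn // ltn_subrL (leq_trans _ mn).
    by exists q => //; rewrite IHn // ltn_subrL (leq_trans _ mn).
  by apply/esym/negbTE/and4P => -[/eqP -> Da an _]; rewrite Da an in Dmn.
case: (ltngtP a m.+1) => [|ma|->].
- by rewrite ltnS => am; rewrite am orbF.
- by rewrite [(a <= m)%N]leqNgt (ltnW ma) !andbF.
- by rewrite ltnn.
Qed.

Lemma restricted_enum_uniq m n : uniq (restricted_enum m n).
Proof.
elim: m n => [|m IHm] n; first by case: n.
elim/ltn_ind: n => n IHn; rewrite restricted_enumS cat_uniq IHm /=.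
case: ifP => // /andP[_ mn]; rewrite map_inj_uniq => [|p q []//].
rewrite IHn ?ltn_subrL ?(leq_trans _ mn) // andbT.
apply/hasPn => _ /mapP[p _ ->]; rewrite /= mem_restricted_enum.
by rewrite restricted_cons ltnn andbF.
Qed.

Definition nb_restricted (m n : nat) : nat := size (restricted_enum m n).

Lemma nb_restricted0 n : nb_restricted 0 n = (n == 0)%N.
Proof. by case: n. Qed.

(** In terms of generating functions, C_m = (1 - x^(m+1)) C_(m+1) when [m.+1] is
    an allowed part. *)
Lemma nb_restrictedS m n :
  nb_restricted m.+1 n =
  (nb_restricted m n +
   (if D m.+1 && (m < n)%N then nb_restricted m.+1 (n - m.+1) else 0))%N.
Proof.
rewrite /nb_restricted restricted_enumS size_cat.
by case: ifP => _; rewrite ?size_map.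
Qed.

(** The parts equal to 1 fill any gap: for the bound 1 the count is constantly
    1, and the recurrence [nb_restrictedS] preserves monotonicity. *)
Lemma leq_nb_restricted m : D 1 ->
  {homo nb_restricted m.+1 : n n' / (n <= n')%N}.
Proof.
move=> D1; elim: m => [|m IHm] n n' nn'.
  have n1 k : nb_restricted 1 k = 1%N.
    elim: k => [|k IHk]; rewrite nb_restrictedS nb_restricted0 ?andbF //.
    by rewrite D1 subn1 /= IHk.
  by rewrite !n1.
elim/ltn_ind: n' n nn' => n' IHn' n nn'.
rewrite (nb_restrictedS m.+1 n) (nb_restrictedS m.+1 n') leq_add ?IHm //.
case: (D m.+2) => //=; case: ltnP => // mn; rewrite (leq_trans mn nn').
by apply: IHn'; lia.
Qed.

Definition restricted_poly (N m : nat) : {poly int} :=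
  \poly_(i < N) (nb_restricted m i)%:R.

(** Congruence modulo 'X^N is compatible with products. *)
Lemma coef_mull_congr (N : nat) (r p q : {poly int}) :
  (forall i, (i < N)%N -> p`_i = q`_i) ->
  forall i, (i < N)%N -> (r * p)`_i = (r * q)`_i.
Proof.
move=> pq i iN; rewrite !coefM; apply: eq_bigr => j _; congr (_ * _).
by apply: pq; rewrite (leq_ltn_trans (leq_subr _ _)).
Qed.

(** The truncated generating function is inverse, modulo 'X^N, to the product of
    the 1 - 'X^j over the allowed parts [j]. *)
Lemma restricted_poly_prod N m i : (i < N)%N ->
  ((\prod_(0 <= j < m | D j.+1) (1 - 'X ^+ j.+1)) * restricted_poly N m)`_i
  = (i == 0)%:R.
Proof.
elim: m i => [|m IHm] i iN.
  by rewrite big_geq // mul1r coef_poly iN nb_restricted0.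
rewrite -(IHm i iN) big_mkcond big_nat_recr //= -big_mkcond /= -mulrA.
apply: (coef_mull_congr _ _ iN) => {iN}i iN.
rewrite [RHS]coef_poly iN; case: ifP => Dm; last first.
  by rewrite mul1r coef_poly iN nb_restrictedS Dm addn0.
rewrite mulrBl mul1r coefB coefXnM !coef_poly iN nb_restrictedS Dm /= ltnS.
case: leqP => im; first by rewrite addn0 subr0.
by rewrite (leq_ltn_trans (leq_subr _ _)) // natrD addrK.
Qed.

End RestrictedPartitions.

(** * Euler's theorem in terms of regular partitions *)

Lemma leq_mem_sumn a p : a \in p -> (a <= sumn p)%N.
Proof.
elim: p => //= b p IH; rewrite inE => /orP[/eqP ->|/IH]; first exact: leq_addr.
by move/leq_trans; apply; apply: leq_addl.
Qed.

(** The parts of a partition of [n] are at most [n], so that any larger bound is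
    harmless; a bound independent of [n] is what generating functions need. *)
Lemma nb_regular_partitions_restricted l m n : (n <= m)%N ->
  nb_regular_partitions l n =
  nb_restricted (fun a => ~~ (l %| a)%N) m n.
Proof.
move=> nm; apply: nb_regular_partitionsE => [|p].
  exact: restricted_enum_uniq.
rewrite mem_restricted_enum /restricted andbA -/(is_regular_partition l n p).
apply: andb_idr => /andP[/and3P[_ _ /eqP sum_p] _]; apply/allP => a.
by move=> /leq_mem_sumn ap; rewrite (leq_trans ap) // sum_p.
Qed.

(** For f j = 1 - x^j this factors (q;q) into the product over the allowed parts
    of [l]-regular partitions and (q^l;q^l). *)
Lemma prod_multiples (R : comNzRingType) (l M : nat) (f : nat -> R) :
  (0 < l)%N ->
  \prod_(0 <= j < l * M) f j.+1 =
  \prod_(0 <= j < l * M | ~~ (l %| j.+1)%N) f j.+1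
  * \prod_(0 <= j < M) f (l * j.+1)%N.
Proof.
case: l => // l _; rewrite (bigID (fun j => l.+1 %| j.+1)%N) /= mulrC.
congr (_ * _); elim: M => [|M IH]; first by rewrite muln0 !big_geq.
rewrite (@big_cat_nat _ _ _ (l.+1 * M)) ?leq_mul //= IH big_nat_recr //=.
congr (_ * _); rewrite mulnSr addnS big_mkcond big_nat_recr ?leq_addr //=.
rewrite -addnS -mulnSr dvdn_mulr // big_nat big1 ?mul1r // => j /andP[lMj jlM].
(* No multiple of l + 1 lies strictly between M (l + 1) and (M + 1)(l + 1). *)
case: ifP => // /dvdnP[q jq]; suff : (M < q < M.+1)%N by lia.
by rewrite -(ltn_pmul2r (ltn0Sn l)) -[(q < _)%N](ltn_pmul2r (ltn0Sn l)) -jq; lia.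
Qed.

Lemma sum_symmetric (V : zmodType) (g : int -> V) (k : nat) :
  \sum_(i < (2 * k).+1) g (i%:Z - k%:Z) =
  g 0 + \sum_(j < k) (g j.+1%:Z + g (- j.+1%:Z)).
Proof.
elim: k => [|k IH]; first by rewrite muln0 big_ord1 big_ord0 !addr0.
rewrite [in RHS]big_ord_recr /= addrA -IH.
have -> : (2 * k.+1 = (2 * k).+2)%N by lia.
rewrite big_ord_recr big_ord_recl /= -addrA addrC -addrA.
have -> : (2 * k).+2%:Z - k.+1%:Z = k.+1%:Z by lia.
rewrite sub0r; congr (_ + _).
by apply: eq_bigr => i _; congr (g _); rewrite /bump /=; lia.
Qed.

Lemma mul2_bin2 n : (2 * 'C(n, 2) = n * n.-1)%N.
Proof. by rewrite -mul_bin_diag bin1. Qed.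

Lemma pent_pos (j : nat) : pent j%:Z = (j * j + 'C(j, 2))%N%:Z.
Proof.
apply: (@mulfI _ 2) => //; rewrite pentE.
by have := mul2_bin2 j; case: j => //= j; nia.
Qed.

Lemma pent_neg (j : nat) : pent (- j%:Z) = (j * j + 'C(j.+1, 2))%N%:Z.
Proof.
by apply: (@mulfI _ 2) => //; rewrite pentE; have := mul2_bin2 j.+1; nia.
Qed.

Lemma absz_pent (j : int) : `|pent j|%N%:Z = pent j.
Proof. by case: (intP j) => [|m|m]; rewrite ?pent_neg ?pent_pos. Qed.

Lemma sum_pent_pair (R : comNzRingType) (x : R) (k : nat) :
  1 + \sum_(j < k) pent_pair x j.+1 =
  \sum_(i < (2 * k).+1)
    (-1) ^+ `|i%:Z - k%:Z|%N * x ^+ `|pent (i%:Z - k%:Z)|%N.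
Proof.
rewrite (sum_symmetric (fun j => (-1) ^+ `|j|%N * x ^+ `|pent j|%N)).
rewrite (pent_pos 0) !expr0 mul1r; congr (_ + _); apply: eq_bigr => j _.
by rewrite pent_pos pent_neg /pent_pair abszN mulrDr.
Qed.

Lemma coef_mul_sum_pent_pair (c x : {poly int}) (k n : nat) :
  (c * (1 + \sum_(j < k) pent_pair x j.+1))`_n =
  \sum_(i < (2 * k).+1)
    (-1) ^+ `|i%:Z - k%:Z|%N * (c * x ^+ `|pent (i%:Z - k%:Z)|%N)`_n.
Proof.
rewrite sum_pent_pair mulr_sumr coef_sum; apply: eq_bigr => i _.
by rewrite mulrCA -(rmorph_sign polyC) coefCM.
Qed.

Lemma signz (j : int) : (-1) ^ j = (-1) ^+ `|j|%N :> int.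
Proof. by case: j => m //; rewrite NegzE -exprz_inv invrN1 abszN. Qed.

(** An index [j] with n = R pent j satisfies |j| <= pent j <= n, so that the
    window |j| <= k contains it, and it is unique by injectivity of [pent]. *)
Lemma rho_sum (R k n : nat) : (0 < R)%N -> (n <= k)%N ->
  \sum_(i < (2 * k).+1)
    (-1) ^+ `|i%:Z - k%:Z|%N * (n == R * `|pent (i%:Z - k%:Z)|)%N%:R
  = rho R n.
Proof.
move=> R0 nk; rewrite /rho; case: pselect => [ex_i|no_i]; last first.
  rewrite big1 // => i _; case: eqP => [ni|_]; last by rewrite mulr0.
  by case: no_i; exists (i%:Z - k%:Z); rewrite ni PoszM absz_pent.
case: (cid ex_i) => j /= nj.
have jk : (`|j| <= k)%N.
  apply: leq_trans nk; have jp : `|j|%N%:Z <= pent j.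
    have := pentE j; have [j0|j0] := leP 0 j; first by nia.
    by nia.
  by rewrite -lez_nat nj; nia.
have i0P : (`|(j + k%:Z)%R| < (2 * k).+1)%N by lia.
rewrite (bigD1 (Ordinal i0P)) //= big1 => [|i ij].
  have -> : `|(j + k%:Z)%R|%N%:Z - k%:Z = j by lia.
  have -> : (n == R * `|pent j|)%N by rewrite -eqz_nat PoszM absz_pent nj.
  by rewrite mulr1 addr0 signz.
case: eqP => [ni|_]; last by rewrite mulr0.
case/eqP: ij; apply: val_inj => /=.
suff -> : j = i%:Z - k%:Z by lia.
apply/pent_inj/(@mulfI _ R%:Z); first by lia.
by rewrite -nj ni PoszM absz_pent.
Qed.

(** Modulo 'X^(M+1), the generating function of b_3 times (q;q) is (q^3;q^3).
    Euler's theorem is used for (q;q) up to degree 3M and for (q^3;q^3) up to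
    degree M in q^3, since splitting off the multiples of 3 from the first 3M
    factors leaves M factors. *)
Lemma b3_pentagonal (n M : nat) : (n <= M)%N ->
  \sum_(i < (2 * (3 * M)).+1)
    (-1) ^+ `|i%:Z - (3 * M)%N%:Z|%N * b3 (n%:Z - pent (i%:Z - (3 * M)%N%:Z))
  = rho 3 n.
Proof.
move=> nM; pose D a := ~~ (3 %| a)%N.
pose B := restricted_poly D M.+1 (3 * M).
pose E x k : {poly int} := 1 + \sum_(j < k) pent_pair x j.+1.
have nM1 : (n < M.+1)%N by [].
have coefE i : (B * 'X^i)`_n = b3 (n%:Z - i%:Z).
  rewrite coefMXn coef_poly; case: ltnP => [ni|i_n].
    by have [a ->] : exists a, n%:Z - i%:Z = Negz a by exists (i - n.+1)%N; lia.
  rewrite (leq_ltn_trans (leq_subr _ _)) // subzn //= /b3.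
  by rewrite -(@nb_regular_partitions_restricted 3) ?natz //; lia.
transitivity (B * E 'X (3 * M)%N)`_n.
  rewrite coef_mul_sum_pent_pair; apply: eq_bigr => i _.
  by rewrite coefE absz_pent.
have [q qE] := pentagonal_congr ('X : {poly int}) (3 * M).
have [r rE] := pentagonal_congr ('X^3 : {poly int}) M.
transitivity (B * qprod 'X 0 (3 * M))`_n.
  rewrite qE -/(E _ _) [in RHS]mulrDr [in RHS]coefD.
  by rewrite (mulrCA B) [X in _ = _ + X]coefXnM ifT ?addr0 //; lia.
rewrite /qprod (prod_multiples M (fun j => 1 - 'X ^+ j)) //.
rewrite mulrA mulrC (mulrC B).
transitivity (qprod ('X^3 : {poly int}) 0 M * 1)`_n.
  under eq_bigr do rewrite exprM.
  apply: (coef_mull_congr (N := M.+1)) => // i iM.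
  by rewrite restricted_poly_prod // coef1.
rewrite mulr1 rE -exprM coefD coefXnM ifT ?addr0; last by lia.
have := coef_mul_sum_pent_pair 1 'X^3 M n; rewrite mul1r => ->.
rewrite -(@rho_sum 3 M) //.
by apply: eq_bigr => i _; rewrite mul1r -exprM coefXn.
Qed.

(** * The alternating tail *)

(** The upper bound is what makes the induction work: removing the first term
    turns the bounds for [k.+1] into the bounds for [k]. *)
Lemma alternating_sum_bounds (d : nat -> int) :
  (forall j, 0 <= d j) -> (forall j, d j.+1 <= d j) ->
  forall m k,
    0 <= (-1) ^+ k * \sum_(k <= j < k + m) (-1) ^+ j * d j <= d k.
Proof.
move=> d_ge0 d_le; elim=> [|m IH] k.
  by rewrite addn0 big_geq // mulr0 lexx d_ge0.
rewrite big_ltn ?addnS ?ltnS ?leq_addr // mulrDr mulrA -expr2 sqrr_sign mul1r.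
have := IH k.+1; rewrite addSn exprS mulN1r mulNr.
move: (_ * \sum_(_ <= _ < _) _) (d_le k) => s; lia.
Qed.

Lemma b3_ge0 x : 0 <= b3 x.
Proof. by case: x. Qed.

Lemma le_b3 x y : x <= y -> b3 x <= b3 y.
Proof.
case: x y => [x|x] [y|y] //= xy; rewrite lez_nat.
rewrite (@nb_regular_partitions_restricted 3 y.+1 x); last by lia.
rewrite (@nb_regular_partitions_restricted 3 y.+1 y); last by lia.
exact: leq_nb_restricted.
Qed.

Theorem theorem1p2 (k : nat) (hk : (1 <= k)%N) (n : nat) :
  0 <= (-1) ^+ k *
         \sum_(i < (2 * k).+1)
           (let j : int := i%:Z - k%:Z in (-1) ^ j * b3 (n%:Z - pent j))
       + (-1) ^+ (k - 1) * rho 3 n.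
Proof.
pose g (j : int) := (-1) ^+ `|j|%N * b3 (n%:Z - pent j).
(* Shifted by one: [d j] groups the indices j + 1 and - (j + 1), so that the
   tail over |j| > k starts at [d k]. *)
pose d j := b3 (n%:Z - pent j.+1%:Z) + b3 (n%:Z - pent (- j.+1%:Z)).
have g_pair (j : nat) : g j.+1%:Z + g (- j.+1%:Z) = - ((-1) ^+ j * d j).
  by rewrite /g abszN -mulrDr exprS mulN1r mulNr.
have partial_sum m :
    \sum_(i < (2 * m).+1) g (i%:Z - m%:Z)
    = g 0 - \sum_(0 <= j < m) (-1) ^+ j * d j.
  rewrite sum_symmetric; under eq_bigr do rewrite g_pair.
  by rewrite sumrN big_mkord.
under eq_bigr do rewrite /= signz.
rewrite -/(g _) partial_sum.
(* Any M >= n gives the complete sum; M >= k moreover makes it extend the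
   given one. *)
pose M := (n + k)%N.
rewrite -(@b3_pentagonal n M) ?leq_addr // partial_sum.
rewrite (@big_cat_nat _ _ _ k _ (3 * M)) //=; last by lia.
have -> : (-1) ^+ (k - 1) = - (-1) ^+ k :> int.
  by rewrite -[in RHS](subnK hk) addn1 exprS mulN1r opprK.
set A := \sum_(0 <= j < k) _; set S := \sum_(k <= j < _) _.
have -> : (-1) ^+ k * (g 0 - A) + - (-1) ^+ k * (g 0 - (A + S)) = (-1) ^+ k * S.
  by ring.
have d_ge0 j : 0 <= d j by rewrite addr_ge0 ?b3_ge0.
have d_le j : d j.+1 <= d j.
  apply: lerD; apply: le_b3; rewrite lerD2l lerN2 ?pent_pos ?pent_neg lez_nat;
    by rewrite leq_add ?leq_mul ?leq_bin2l.
have := alternating_sum_bounds d_ge0 d_le (3 * M - k) k.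
by rewrite subnKC; [case/andP | lia].
Qed.
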